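(* Let $\mathcal{C}$ be a permutation class and let $G_{\mathcal{C}}$ be the corresponding class of inversion graphs. Then $\mathcal{C}$ is geometrically griddable if and only if $G_{\mathcal{C}}$ has bounded lettericity.
   Context: **Permutations.** A permutation $\pi=\pi(1)\cdots\pi(n)$ of length $n$ is an ordering of $\{1,\dots,n\}$. It contains the permutation $\sigma$ of length $k$ if it has a (not necessarily consecutive) subsequence of length $k$ with the same pairwise comparisons as $\sigma$. A permutation class is a set of (finite) permutations closed downward under containment. **Inversion graphs.** All graphs are finite, simple and undirected. The inversion graph $G_\pi$ has vertex set $\{1,\dots,n\}$, with $i\sim j$ if and only if $(i-j)(\pi(i)-\pi(j))<0$. For a permutation class $\mathcal{C}$, $G_{\mathcal{C}}$ is the class of all graphs isomorphic to $G_\pi$ for some $\pi\in\mathcal{C}$. **Lettericity.** Let $\Sigma$ be a finite alphabet and let $D\subseteq\Sigma^2$ be a set of ordered pairs (a decoder). For a word $w=w(1)\cdots w(n)\in\Sigma^*$, the letter graph $\Gamma_D(w)$ has vertex set $\{1,\dots,n\}$ and edge set $\{ij : i<j \text{ and } (w(i),w(j))\in D\}$. The lettericity of a graph $G$ is the least $k$ such that $G\cong\Gamma_D(w)$ for some alphabet $\Sigma$ with $|\Sigma|=k$, some decoder $D\subseteq\Sigma^2$ and some word $w\in\Sigma^*$. A graph class has bounded lettericity if there is a constant $r$ such that every graph in the class has lettericity at most $r$. **Geometric griddability.** Matrices are indexed in cartesian coordinates: a $0/\pm1$ matrix $M$ of size $t\times u$ has $t$ columns and $u$ rows, and $M(i,j)$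 is the entry in column $i$ (from the left) and row $j$ (from the bottom). The standard figure of $M$ is the subset of $\mathbb{R}^2$ that is the union of the increasing open line segments from $(i-1,j-1)$ to $(i,j)$ for those $(i,j)$ with $M(i,j)=1$, and the decreasing open line segments from $(i-1,j)$ to $(i,j-1)$ for those $(i,j)$ with $M(i,j)=-1$. A permutation $\pi$ of length $n$ can be drawn on this figure if there is a set of $n$ points of the figure, no two on a common horizontal or vertical line, such that labeling the points $1$ to $n$ from bottom to top and reading the labels from left to right gives $\pi$. $\operatorname{Geom}(M)$ is the set of all permutations that can be drawn on the standard figure of $M$. A permutation class $\mathcal{C}$ is geometrically griddable if $\mathcal{C}\subseteq\operatorname{Geom}(M)$ for some (finite) $0/\pm1$ matrix $M$. *)

(* Defs.v *)
From HB Require Import structures.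
From mathcomp Require Import all_boot all_order all_algebra all_fingroup.
From mathcomp Require Import boolp classical_sets reals.
Set Implicit Arguments.
Unset Strict Implicit.
Unset Printing Implicit Defensive.
Import Order.TTheory GRing.Theory Num.Theory.

Local Open Scope ring_scope.

(* A permutation of length n is an element of 'S_n: positions and values are
   numbered from 0, and the empty permutation (n = 0) is included. *)

Definition contains (n k : nat) (p : 'S_n) (s : 'S_k) : Prop :=
  exists f : 'I_k -> 'I_n,
    (forall i j : 'I_k, (i < j)%N -> (f i < f j)%N) /\
    (forall i j : 'I_k, (p (f i) < p (f j))%N = (s i < s j)%N).

Definition perm_set : Type := forall n : nat, 'S_n -> Prop.

Definition perm_class (C : perm_set) : Prop :=
  forall (n k : nat) (p : 'S_n) (s : 'S_k), C n p -> contains p s -> C k s.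

Record sgraph : Type := SGraph {
  vertex :> finType;
  adj : rel vertex;
  adj_sym : symmetric adj;
  adj_irrefl : irreflexive adj
}.
Arguments adj {s} : rename.

Definition graph_iso (G H : sgraph) : Prop :=
  exists f : G -> H, bijective f /\ (forall x y : G, adj (f x) (f y) = adj x y).

Definition inv_adj (n : nat) (p : 'S_n) : rel 'I_n := fun i j =>
  (i%:Z - j%:Z) * ((p i)%:Z - (p j)%:Z) < 0.

Lemma inv_adj_sym (n : nat) (p : 'S_n) : symmetric (inv_adj p).
Proof. by move=> i j; rewrite /inv_adj -mulrNN !opprB. Qed.

Lemma inv_adj_irrefl (n : nat) (p : 'S_n) : irreflexive (inv_adj p).
Proof. by move=> i; rewrite /inv_adj subrr mul0r ltxx. Qed.

Definition inversion_graph (n : nat) (p : 'S_n) : sgraph :=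
  SGraph (@inv_adj_sym n p) (@inv_adj_irrefl n p).

Definition inversion_graph_class (C : perm_set) (G : sgraph) : Prop :=
  exists (n : nat) (p : 'S_n), C n p /\ graph_iso G (inversion_graph p).

Definition letter_adj (S : finType) (D : {set S * S}) (n : nat)
    (w : n.-tuple S) : rel 'I_n := fun i j =>
  ((i < j)%N && ((tnth w i, tnth w j) \in D)) ||
  ((j < i)%N && ((tnth w j, tnth w i) \in D)).

Lemma letter_adj_sym (S : finType) (D : {set S * S}) (n : nat)
  (w : n.-tuple S) : symmetric (letter_adj D w).
Proof. by move=> i j; rewrite /letter_adj orbC. Qed.

Lemma letter_adj_irrefl (S : finType) (D : {set S * S}) (n : nat)
  (w : n.-tuple S) : irreflexive (letter_adj D w).
Proof. by move=> i; rewrite /letter_adj ltnn. Qed.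

Definition letter_graph (S : finType) (D : {set S * S}) (n : nat)
    (w : n.-tuple S) : sgraph :=
  SGraph (@letter_adj_sym S D n w) (@letter_adj_irrefl S D n w).

Definition is_letter_graph (G : sgraph) (k : nat) : Prop :=
  exists (S : finType) (D : {set S * S}) (n : nat) (w : n.-tuple S),
    #|S| = k /\ graph_iso G (letter_graph D w).

Lemma is_letter_graph_card (G : sgraph) : is_letter_graph G #|G|.
Proof.
exists (vertex G), [set xy : G * G | adj xy.1 xy.2], #|G|.
exists [tuple enum_val i | i < #|G|]; split=> //.
exists enum_rank; split; first exact: enum_rank_bij.
move=> x y; rewrite /= /letter_adj !tnth_mktuple !enum_rankK !inE /=.
rewrite (adj_sym y x) -andb_orl -neq_ltn.
case: eqVneq => [/val_inj/enum_rank_inj -> | _] //=.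
by rewrite adj_irrefl.
Qed.

Lemma ex_is_letter_graph (G : sgraph) : exists k, `[< is_letter_graph G k >].
Proof. by exists #|G|; apply/asboolP/is_letter_graph_card. Qed.

Definition lettericity (G : sgraph) : nat := ex_minn (ex_is_letter_graph G).

Definition bounded_lettericity (X : sgraph -> Prop) : Prop :=
  exists r : nat, forall G : sgraph, X G -> (lettericity G <= r)%N.

Definition zero_pm1_matrix (t u : nat) (M : 'M[int]_(t, u)) : Prop :=
  forall i j, M i j \in [:: 0; 1; -1].

Definition open_segment (R : realType) (a b : R * R) : set (R * R) :=
  [set z | exists2 s : R, 0 < s < 1 &
    z = ((1 - s) * a.1 + s * b.1, (1 - s) * a.2 + s * b.2)].

(* Matrices are indexed in cartesian coordinates: in M i j, the first index i
   is the column (from the left) and j the row (from the bottom).  With indices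
   starting at 0, the cell (i, j) is the square [i, i+1] x [j, j+1]. *)
Definition standard_figure (R : realType) (t u : nat) (M : 'M[int]_(t, u)) :
    set (R * R) :=
  [set z | exists (i : 'I_t) (j : 'I_u),
    (M i j = 1 /\ open_segment (i%:R, j%:R) (i.+1%:R, j.+1%:R) z) \/
    (M i j = -1 /\ open_segment (i%:R, j.+1%:R) (i.+1%:R, j%:R) z)].

(* z lists the points from left to right, so that the point z i carries the
   label p i; the last clause says that the labels increase from bottom to top.
   As p is injective, it also forces distinct second coordinates. *)
Definition drawn_on (R : realType) (n : nat) (p : 'S_n) (F : set (R * R)) :
    Prop :=
  exists z : 'I_n -> R * R,
    [/\ forall i, F (z i),
        forall i j : 'I_n, (i < j)%N -> (z i).1 < (z j).1
      & forall i j : 'I_n, (p i < p j)%N -> (z i).2 < (z j).2].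

Definition Geom (R : realType) (t u : nat) (M : 'M[int]_(t, u)) : perm_set :=
  fun n p => drawn_on p (@standard_figure R t u M).

Definition geometrically_griddable (R : realType) (C : perm_set) : Prop :=
  exists (t u : nat) (M : 'M[int]_(t, u)),
    zero_pm1_matrix M /\ (forall (n : nat) (p : 'S_n), C n p -> Geom R M p).

(* Main.v *)
Require Import Defs.
From mathcomp Require Import all_boot all_order all_algebra all_fingroup.
From mathcomp Require Import reals.
From mathcomp Require Import zify ring lra.

(** Both directions rest on one dictionary.  A permutation is read as a finite
    set of points with a horizontal position [x] and a vertical position [y];
    its inversions are the pairs that [x] and [y] order differently.  A letter
    graph structure on the inversion graph colours the points with letters and
    places them in time, so that the colours of two points and their order in
    time decide whether they form an inversion.  A drawing on a standard figure
    gives more: there, colours and time decide both the horizontal and the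
    vertical order of two points.

    From drawings to letters.  The time of a point of the figure is the distance
    from its abscissa to the nearest integer, which equals that of its ordinate
    because the segments have slope 1 or -1; its letter records the cell and the
    half of the segment that contain it.  Two points in a common half column
    move in the same direction as time increases, and likewise for half rows,
    so letters and time decide both orders ([geom_letter_graph]).

    From letters to drawings there are three obstacles.

    First, inversions have to be turned into orders.  The points with a given
    letter form a monotone sequence, and the inversions between two such
    sequences contain no two independent edges.  It follows that, once each
    letter is split according to which letters occur in the four quadrants
    around a point, any two parts are separated by a horizontal or vertical
    line or are jointly monotone ([sep_or_homogeneous]).  Cutting the plane at
    the extreme points of all the parts gives a grid of bounded size with
    monotone cells ([cell_homogeneous]).

    Secondly, inversions do not see how the points of a cell are ordered when no
    point outside the cell separates them horizontally or vertically; such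
    points form an interval of the permutation.  One representative of each
    interval keeps its letter and its time, and the other points are recoloured
    and moved next to it ([twin_times]).

    Thirdly, the order of representatives within a cell has to be recovered.
    Two of them are separated by a point outside the cell, say horizontally.
    That point lies in another row, so that inversions with it are comparisons
    of [x], and these are comparisons of times up to a sign.  A class of points
    cannot be split with both signs ([class_agree]); cutting again at the
    extreme points forces the signs of two colours of one cell to coincide as
    soon as a point separates them ([cross_sign]).  Hence colours and time now
    decide both orders ([retime_x], [retime_y]).

    A last round of cuts makes each column move in one direction as time
    increases, and each row too ([column_agree]).  Drawing every point at a
    distance determined by its time, from the left or the right according to its
    column and from below or above according to its row, puts it on the
    figure of a checkerboard matrix whose size depends on the number of
    letters only ([geom_of_determined]). *)

Set Implicit Arguments.
Unset Strict Implicit.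
Unset Printing Implicit Defensive.
Import Order.TTheory GRing.Theory Num.Theory.
Local Open Scope ring_scope.

(** * Discordant pairs and inversions *)

Section Discordance.
Variable T : finType.
Implicit Types (x y : T -> int) (p q : T).

Definition discordant x y p q := (x p < x q) (+) (y p < y q).

Lemma discordant_sym x y : injective x -> injective y -> symmetric (discordant x y).
Proof.
move=> xI yI p q; rewrite /discordant; have [->//|npq] := eqVneq p q.
have := inj_eq xI p q; have := inj_eq yI p q; lia.
Qed.

Lemma discordant_swap x y p q : discordant y x p q = discordant x y p q.
Proof. by rewrite /discordant addbC. Qed.

End Discordance.

Definition abscissa n : 'I_n -> int := fun i => i%:Z.
Definition ordinate n (p : 'S_n) : 'I_n -> int := fun i => (p i)%:Z.

Lemma abscissa_inj n : injective (@abscissa n).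
Proof. by move=> i j [] /val_inj. Qed.

Lemma ordinate_inj n (p : 'S_n) : injective (ordinate p).
Proof. by move=> i j [] /val_inj/perm_inj. Qed.

Lemma inv_adj_discordant n (p : 'S_n) i j : i != j ->
  inv_adj p i j = discordant (@abscissa n) (ordinate p) i j.
Proof.
move=> nij; have := nij; rewrite -(inj_eq (@ordinate_inj _ p)) => np.
have := nij; rewrite -(inj_eq (@abscissa_inj _)) => nx.
move: np nx; rewrite /inv_adj /discordant /abscissa /ordinate.
move: (i%:Z) (j%:Z) (p i)%:Z (p j)%:Z => a b d e nde nab.
have [lt|gt|e1] := ltgtP a b; last by rewrite e1 eqxx in nab.
  by rewrite nmulr_rlt0 ?subr_lt0 // subr_gt0; move: nde; clear; lia.
by rewrite pmulr_rlt0 ?subr_gt0 // subr_lt0.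
Qed.

(** * Permutations drawn on a figure have letter graphs *)

(** The order of the word only has to be compatible with the weak inequality
    of times: points with equal times may be listed in either order, since the
    hypothesis applies to them both ways. *)
Lemma letter_graph_of_order (n : nat) (p : 'S_n) (S : finType) (R : realType)
    (c : 'I_n -> S) (s : 'I_n -> R) (D : {set S * S}) :
  (forall i j, i != j -> s i <= s j -> inv_adj p i j = ((c i, c j) \in D)) ->
  is_letter_graph (inversion_graph p) #|S|.
Proof.
move=> hD; pose le := [rel i j : 'I_n | s i <= s j].
pose q := sort le (enum 'I_n).
have qs : size q = n by rewrite size_sort -cardE card_ord.
have qu : uniq q by rewrite sort_uniq enum_uniq.
have qm i : i \in q by rewrite mem_sort mem_enum.
have ix i : (index i q < n)%N by rewrite -[X in (_ < X)%N]qs index_mem.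
have le_tr : transitive le by move=> a b d; apply: le_trans.
have qsorted : sorted le q by apply: sort_sorted => a b; apply: le_total.
have ixs i j : (index i q < index j q)%N -> s i <= s j.
  move=> /ltnW h; have := sorted_leq_nth le_tr (fun a => lexx (s a)) i qsorted.
  move=> /(_ (index i q) (index j q)); rewrite !inE !index_mem !nth_index //.
  by apply.
pose w := mktuple (fun k : 'I_n => c (tnth (Tuple (introT eqP qs)) k)).
exists S, D, n, w; split=> //.
pose f i := Ordinal (ix i).
have fI : injective f.
  by move=> i j [] e; rewrite -(nth_index i (qm i)) e nth_index.
exists f; split; first exact: injF_bij.
have cf i : tnth w (f i) = c i.
  by rewrite tnth_mktuple (tnth_nth i) /= nth_index.
move=> i j; have [->|nij] := eqVneq i j; first by rewrite !adj_irrefl.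
rewrite /= /letter_adj !cf /=.
have [lt|gt|e] := ltngtP (index i q) (index j q) => /=.
- by rewrite orbF hD // ixs.
- by rewrite inv_adj_sym hD 1?eq_sym // ixs.
- by case/eqP: nij; apply/fI/val_inj.
Qed.

Lemma lettericity_le G k : is_letter_graph G k -> (lettericity G <= k)%N.
Proof.
move=> h; rewrite /lettericity; case: ex_minnP => m _; apply.
exact/boolp.asboolP.
Qed.

Lemma is_letter_graph_iso G H k :
  graph_iso G H -> is_letter_graph H k -> is_letter_graph G k.
Proof.
case=> f [fB fA] [S [D [n [w [cS [g [gB gA]]]]]]].
exists S, D, n, w; split=> //; exists (g \o f); split; first exact: bij_comp.
by move=> a b; rewrite -fA -gA.
Qed.

(** The position [f] in the unit interval is [s] away from the nearer end,
    which is 0 when [e] holds and 1 otherwise. *)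
Definition folded (R : realType) (e : bool) (f s : R) :=
  if e then (f <= 2^-1) && (s == f) else (2^-1 <= f) && (s == 1 - f).

Lemma folded_flip (R : realType) (e : bool) (f s : R) :
  folded e f s -> folded (~~ e) (1 - f) s.
Proof. by case: e => /andP[h /eqP ->]; apply/andP; split; [lra|apply/eqP; lra|lra|]. Qed.

(** Within one interval, two points in different halves are ordered by their
    halves. In the same half, the distances to the common nearer end order
    them, increasingly in the first half and decreasingly in the second. So
    the half [e] of the first point always tells the answer when its distance
    is the smaller one. *)
Lemma folded_lt (R : realType) (a a' : nat) (e e' : bool) (f f' s s' : R) :
  0 < f < 1 -> 0 < f' < 1 -> folded e f s -> folded e' f' s' -> s <= s' ->
  a%:R + f != a'%:R + f' ->
  (a%:R + f < a'%:R + f') = if a == a' then e else (a < a')%N.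
Proof.
move=> /andP[f0 f1] /andP[f0' f1'] hf hf' le.
have [->|na] := eqVneq a a'.
  rewrite (inj_eq (addrI _)) ltrD2l => nf.
  case: e e' hf hf' => [] [] /andP[h1 /eqP e1] /andP[h2 /eqP e2]; subst.
  - by rewrite lt_neqAle nf.
  - by rewrite lt_neqAle nf; lra.
  - by apply/negbTE; rewrite -leNgt; lra.
  - by apply/negbTE; rewrite -leNgt; lra.
move=> _; have [lt|gt|//] := ltngtP a a'; last by move=> e0; rewrite e0 eqxx in na.
  have : a.+1%:R <= a'%:R :> R by rewrite ler_nat.
  rewrite -natr1; lra.
have : a'.+1%:R <= a%:R :> R by rewrite ler_nat.
by rewrite -natr1 => h; apply/negbTE; rewrite -leNgt; lra.
Qed.

(** The horizontal half of a point determines its vertical half: they are the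
    same on increasing segments and opposite on decreasing ones. Points with
    equal distances are harmless, because distinct points of the drawing share
    no coordinate. *)
Lemma geom_letter_graph (R : realType) t u (M : 'M[int]_(t, u)) n (p : 'S_n) :
  Geom R M p -> is_letter_graph (inversion_graph p) #|{: 'I_t * 'I_u * bool}|.
Proof.
case=> z [zF zx zy].
have point i : exists d : 'I_t * 'I_u * R, [/\ 0 < d.2 < 1, (z i).1 = d.1.1%:R + d.2
    & (z i).2 = d.1.2%:R + (if M d.1.1 d.1.2 == 1 then d.2 else 1 - d.2)].
  have [a [b [[M1 [s s01 ->]]|[M1 [s s01 ->]]]]] := zF i; exists (a, b, s);
    split=> //=; rewrite ?M1 /= -!natr1; ring.
have {zF point} [d hd] := fin_all_exists point.
pose e i := (d i).2 <= 2^-1.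
pose s i := if e i then (d i).2 else 1 - (d i).2.
have sP i : folded (e i) (d i).2 (s i).
  rewrite /folded /s; have [h|h] := boolP (e i); first by rewrite eqxx andbT.
  by rewrite eqxx andbT; move: h; rewrite /e -ltNge => /ltW.
pose D := [set k : ('I_t * 'I_u * bool) * ('I_t * 'I_u * bool) |
  (if k.1.1.1 == k.2.1.1 then k.1.2 else (k.1.1.1 < k.2.1.1)%N) (+)
  (if k.1.1.2 == k.2.1.2 then k.1.2 == (M k.1.1.1 k.1.1.2 == 1)
   else (k.1.1.2 < k.2.1.2)%N)].
apply: (@letter_graph_of_order n p _ R (fun i => ((d i).1, e i)) s D) => i j nij le.
rewrite inv_adj_discordant // inE /=.
have [di ei1 ei2] := hd i; have [dj ej1 ej2] := hd j.
have npij : p i != p j by rewrite (inj_eq perm_inj).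
have eqx : (abscissa i < abscissa j) = ((z i).1 < (z j).1).
  rewrite /abscissa ltz_nat; have [lt|gt|eq] := ltngtP i j;
    last by case/eqP: nij; apply: val_inj.
    by rewrite zx.
  by rewrite ltNge ltW // zx.
have eqy : (ordinate p i < ordinate p j) = ((z i).2 < (z j).2).
  rewrite /ordinate ltz_nat; have [lt|gt|eq] := ltngtP (p i) (p j);
    last by case/eqP: npij; apply: val_inj.
    by rewrite zy.
  by rewrite ltNge ltW // zy.
have nx : (z i).1 != (z j).1.
  have [lt|gt|eq] := ltngtP i j; last by case/eqP: nij; apply: val_inj.
    by rewrite lt_eqF // zx.
  by rewrite gt_eqF // zx.
have ny : (z i).2 != (z j).2.
  have [lt|gt|eq] := ltngtP (p i) (p j);
    last by case/eqP: npij; apply: val_inj.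
    by rewrite lt_eqF // zy.
  by rewrite gt_eqF // zy.
rewrite /discordant eqx eqy ei1 ei2 ej1 ej2.
rewrite ei1 ej1 in nx; rewrite ei2 ej2 in ny.
have row k : folded (e k == (M (d k).1.1 (d k).1.2 == 1))
    (if M (d k).1.1 (d k).1.2 == 1 then (d k).2 else 1 - (d k).2) (s k).
  case: (M _ _ == 1); first by rewrite eqb_id.
  by rewrite eqbF_neg; apply: folded_flip.
have unit k : 0 < (d k).2 < 1 ->
    0 < (if M (d k).1.1 (d k).1.2 == 1 then (d k).2 else 1 - (d k).2) < 1.
  by case: ifP => // _ /andP[h h']; apply/andP; split; lra.
rewrite (folded_lt di dj (sP i) (sP j) le nx).
by rewrite (folded_lt (unit i di) (unit j dj) (row i) (row j) le ny).
Qed.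

(** * Two letters, up to finitely many parts *)

(* Solves a goal about positions from the comparisons in the context, after
   discarding the hypotheses that do not compare positions. *)
Ltac ord := repeat match goal with
  | H : is_true (?A _) |- _ => is_var A; clear H
  | H : is_true (discordant _ _ _ _) |- _ => clear H
  end; lia.

Section Separation.
Variable T : finType.
Implicit Types (x y f : T -> int) (A B P Q : pred T).

Definition homogeneous x y v A :=
  forall p q, A p -> A q -> p != q -> discordant x y p q = v.

(** No two independent edges. Between two letters, the edges of a letter graph
    compare times, unless all or none of the pairs are edges, and so have this
    property. *)
Definition cross_free x y A B := forall a a' b b', A a -> A a' -> B b -> B b' ->
  ~~ [&& discordant x y a b, discordant x y a' b',
         ~~ discordant x y a b' & ~~ discordant x y a' b].

Definition separated f P Q :=
  (forall p q, P p -> Q q -> f p < f q) \/ (forall p q, P p -> Q q -> f q < f p).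

(** The Booleans [u] and [v] select one of the four quadrants around [p]. *)
Definition occupied x y B (u v : bool) p :=
  [exists b, [&& B b, (x p < x b) == u & (y p < y b) == v]].

Definition alike x y P B := forall u v a a', P a -> P a' ->
  occupied x y B u v a -> occupied x y B u v a'.

Lemma separated_sym f P Q : separated f P Q -> separated f Q P.
Proof. by case=> h; [right|left] => p q Pp Qq; apply: h. Qed.

(** If some [b1] were to the left of some [a1] and some [a2] below some [b2],
    then the neighbours of these four points, together with monotonicity and
    the absence of two independent edges, force [a1] to be discordant with
    [b2] and [a2] with [b1]: two independent edges. *)
Lemma sep_core x y A B P Q : injective x -> injective y ->
  homogeneous x y false A -> homogeneous x y false B ->
  (forall a, A a -> ~~ B a) -> cross_free x y A B ->
  (forall a, P a -> A a) -> (forall b, Q b -> B b) ->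
  (forall a, P a -> exists2 b, B b & (x a < x b) && (y b < y a)) ->
  (forall b, Q b -> exists2 a, A a & (x a < x b) && (y b < y a)) ->
  (forall a b, P a -> Q b -> x a < x b) \/ (forall a b, P a -> Q b -> y b < y a).
Proof.
move=> xI yI hA hB dAB cf sP sQ hP hQ.
have iA p q : A p -> A q -> (x p < x q) = (y p < y q).
  move=> Ap Aq; have [->|/(hA _ _ Ap Aq)] := eqVneq p q;
    by rewrite ?ltxx // /discordant; case: (x p < _); case: (y p < _).
have iB p q : B p -> B q -> (x p < x q) = (y p < y q).
  move=> Ap Aq; have [->|/(hB _ _ Ap Aq)] := eqVneq p q;
    by rewrite ?ltxx // /discordant; case: (x p < _); case: (y p < _).
have f2 a a' b b' : A a -> A a' -> B b -> B b' ->
    discordant x y a b -> discordant x y a' b' ->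
    discordant x y a b' || discordant x y a' b.
  move=> Aa Aa' Bb Bb' h h'; have := cf _ _ _ _ Aa Aa' Bb Bb'.
  by rewrite h h' /= negb_and !negbK.
have nx a b : A a -> B b -> (x a != x b) && (y a != y b).
  move=> Aa Bb; rewrite (inj_eq xI) (inj_eq yI) andbb.
  by apply: contraTneq Bb => <-; apply: dAB.
(* a1, b1 witness that P is not on the left of Q, and a2, b2 that it is not
   above Q *)
have [/forallP h|/forallPn[a1 /forallPn[b1]]] :=
  boolP [forall a, forall b, P a ==> Q b ==> (x a < x b)].
  left=> a b Pa Qb; exact: (implyP (implyP (forallP (h a) b) Pa) Qb).
rewrite !negb_imply -leNgt => /and3P[Pa1 Qb1 le1]; right=> a2 b2 Pa2 Qb2.
rewrite ltNge; apply/negP => le2.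
have [Aa1 Aa2] := (sP _ Pa1, sP _ Pa2); have [Bb1 Bb2] := (sQ _ Qb1, sQ _ Qb2).
have [b3 Bb3 /andP[x13 y31]] := hP _ Pa1.
have [b4 Bb4 /andP[x24 y42]] := hP _ Pa2.
have [a3 Aa3 /andP[x31 y13]] := hQ _ Qb1.
have [a4 Aa4 /andP[x42 y24]] := hQ _ Qb2.
have iAx p q : A p -> A q -> x p < x q -> y p < y q by move=> Ap Aq; rewrite (iA p q).
have iAy p q : A p -> A q -> y p < y q -> x p < x q by move=> Ap Aq; rewrite (iA p q).
have iBx p q : B p -> B q -> x p < x q -> y p < y q by move=> Bp Bq; rewrite (iB p q).
have iBy p q : B p -> B q -> y p < y q -> x p < x q by move=> Bp Bq; rewrite (iB p q).
have nLL p q : x p < x q -> y p < y q -> discordant x y p q = false.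
  by rewrite /discordant => -> ->.
have nUR p q : x q < x p -> y q < y p -> discordant x y p q = false.
  by move=> /ltW h /ltW k; rewrite /discordant !ltNge h k.
have dUL p q : (x p < x q) && (y q < y p) -> discordant x y p q.
  by case/andP=> h /ltW k; rewrite /discordant h ltNge k.
have d13 : discordant x y a1 b3 by apply: dUL; ord.
have d24 : discordant x y a2 b4 by apply: dUL; ord.
have d31 : discordant x y a3 b1 by apply: dUL; ord.
have d42 : discordant x y a4 b2 by apply: dUL; ord.
have y3 : y a3 < y a1 by apply: iAx => //; ord.
have x4 : x a2 < x a4 by apply: iAy => //; ord.
have y3' : y b1 < y b3 by apply: iBx => //; ord.
have x4' : x b4 < x b2 by apply: iBy => //; ord.
(* If b2 is on the upper right of a1, the edges a3 b1 and a4 b2 are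
   independent; if it is on the lower left, a2 b4 and a1 b3 are *)
have h12 : discordant x y a1 b2.
  have [lt|ge] := ltP (x a1) (x b2); have [lt'|ge'] := ltP (y b2) (y a1).
  - by apply: dUL; rewrite lt.
  - have x14 : x a1 < x a4 by apply: iAy => //; ord.
    by have := f2 _ _ _ _ Aa3 Aa4 Bb1 Bb2 d31 d42;
      rewrite (nLL a3 b2) ?(nUR a4 b1) //; ord.
  - have y23 : y b2 < y b3 by apply: iBx => //; ord.
    by have := f2 _ _ _ _ Aa2 Aa1 Bb4 Bb3 d24 d13;
      rewrite (nLL a2 b3) ?(nUR a1 b4) //; ord.
  - have : y b2 < y b3 by apply: iBx => //; ord.
    by ord.
have h21 : discordant x y a2 b1.
  have [lt|ge] := ltP (x a2) (x b1); have [lt'|ge'] := ltP (y b1) (y a2).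
  - by apply: dUL; rewrite lt.
  - have x14 : x b4 < x b1 by apply: iBy => //; ord.
    by have := f2 _ _ _ _ Aa2 Aa1 Bb4 Bb3 d24 d13;
      rewrite (nLL a2 b3) ?(nUR a1 b4) //; ord.
  - have y23 : y a3 < y a2 by apply: iAx => //; ord.
    by have := f2 _ _ _ _ Aa3 Aa4 Bb1 Bb2 d31 d42;
      rewrite (nLL a3 b2) ?(nUR a4 b1) //; ord.
  - have : y b1 < y b4 by apply: iBx => //; ord.
    by ord.
have := f2 _ _ _ _ Aa1 Aa2 Bb2 Bb1 h12 h21.
have /andP[n1 _] := nx _ _ Aa1 Bb1; have /andP[_ n2] := nx _ _ Aa2 Bb2.
have y11 : y b1 < y a1 by ord.
have x22 : x a2 < x b2 by ord.
by rewrite nUR ?nLL //; ord.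
Qed.

(** If a discordant pair exists, with its point of [P] on the upper left say,
    then all points of [P] see [B] on the lower right and all points of [Q]
    see [A] on the upper left, as one point of each does; this is the
    situation of [sep_core]. *)
Lemma sep_increasing x y A B P Q : injective x -> injective y ->
  homogeneous x y false A -> homogeneous x y false B ->
  (forall a, A a -> ~~ B a) -> cross_free x y A B ->
  (forall a, P a -> A a) -> (forall b, Q b -> B b) ->
  alike x y P B -> alike x y Q A ->
  [\/ separated x P Q, separated y P Q |
      forall p q, P p -> Q q -> discordant x y p q = false].
Proof.
move=> xI yI hA hB dAB cf sP sQ oP oQ.
have nxy a b : A a -> B b -> (x a != x b) && (y a != y b).
  move=> Aa Bb; rewrite (inj_eq xI) (inj_eq yI) andbb.
  by apply: contraTneq Bb => <-; apply: dAB.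
have dBA b : B b -> ~~ A b by apply/contraL/dAB.
have cf' : cross_free x y B A.
  move=> a a' b b' Ba Ba' Ab Ab'.
  rewrite !(discordant_sym xI yI a) !(discordant_sym xI yI a').
  by have := cf _ _ _ _ Ab Ab' Ba Ba'; apply: contraNN; do 4!case: (discordant _ _ _ _).
have [/existsP[p0 /existsP[q0 /and4P[Pp0 Qq0 lx ly]]]|noUL] :=
    boolP [exists p, exists q, [&& P p, Q q, x p < x q & y q < y p]].
  have [||h|h] := @sep_core x y A B P Q xI yI hA hB dAB cf sP sQ.
  - move=> a Pa; have /existsP[b /and3P[Bb]] : occupied x y B true false a.
      apply: oP Pp0 Pa _; apply/existsP; exists q0.
      by rewrite sQ // lx ltNge ltW.
    move=> /eqP hx /eqP hy; exists b => //; rewrite hx /=.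
    have := nxy _ _ (sP _ Pa) Bb; lia.
  - move=> b Qb; have /existsP[a /and3P[Aa]] : occupied x y A false true b.
      apply: oQ Qq0 Qb _; apply/existsP; exists p0.
      by rewrite sP // ly ltNge ltW.
    move=> /eqP hx /eqP hy; exists a => //; rewrite hy andbT.
    have := nxy _ _ Aa (sQ _ Qb); lia.
  - by apply: Or31; left.
  - by apply: Or32; right.
have [/existsP[p0 /existsP[q0 /and4P[Pp0 Qq0 lx ly]]]|noLR] :=
    boolP [exists p, exists q, [&& P p, Q q, x q < x p & y p < y q]].
  have [||h|h] := @sep_core x y B A Q P xI yI hB hA dBA cf' sQ sP.
  - move=> b Qb; have /existsP[a /and3P[Aa]] : occupied x y A true false b.
      apply: oQ Qq0 Qb _; apply/existsP; exists p0.
      by rewrite sP // lx ltNge ltW.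
    move=> /eqP hx /eqP hy; exists a => //; rewrite hx /=.
    have := nxy _ _ Aa (sQ _ Qb); lia.
  - move=> a Pa; have /existsP[b /and3P[Bb]] : occupied x y B false true a.
      apply: oP Pp0 Pa _; apply/existsP; exists q0.
      by rewrite sQ // ly ltNge ltW.
    move=> /eqP hx /eqP hy; exists b => //; rewrite hy andbT.
    have := nxy _ _ (sP _ Pa) Bb; lia.
  - by apply: Or31; right=> p q Pp Qq; apply: h.
  - by apply: Or32; left=> p q Pp Qq; apply: h.
apply: Or33 => p q Pp Qq.
have := existsPn (existsPn noUL p) q; have := existsPn (existsPn noLR p) q.
have := nxy _ _ (sP _ Pp) (sQ _ Qq); rewrite Pp Qq /discordant /=; lia.
Qed.

(** An increasing and a decreasing sequence cross in at most one place.
    Whether [P] sees [B] on the lower left tells on which side of the crossing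
    [P] lies, and whether [Q] sees [A] on the upper left does the same for
    [Q]; each of the four combinations gives one separation. *)
Lemma sep_inc_dec x y A B P Q : injective x -> injective y ->
  homogeneous x y false A -> homogeneous x y true B ->
  (forall a, A a -> ~~ B a) ->
  (forall a, P a -> A a) -> (forall b, Q b -> B b) ->
  alike x y P B -> alike x y Q A ->
  separated x P Q \/ separated y P Q.
Proof.
move=> xI yI hA hB dAB sP sQ oP oQ.
have nxy a b : A a -> B b -> (x a != x b) && (y a != y b).
  move=> Aa Bb; rewrite (inj_eq xI) (inj_eq yI) andbb.
  by apply: contraTneq Bb => <-; apply: dAB.
have iA p q : A p -> A q -> x p < x q -> y q < y p -> False.
  move=> Ap Aq h k; have npq : p != q by apply: contraTneq h => ->; rewrite ltxx.
  by have := hA _ _ Ap Aq npq; rewrite /discordant h ltNge ltW.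
have iB p q : B p -> B q -> x p < x q -> y p < y q -> False.
  move=> Bp Bq h k; have npq : p != q by apply: contraTneq h => ->; rewrite ltxx.
  by have := hB _ _ Bp Bq npq; rewrite /discordant h k.
have [/existsP[p0 /andP[Pp0 o0]]|nP] :=
  boolP [exists p, P p && occupied x y B false false p];
have [/existsP[q0 /andP[Qq0 k0]]|nQ] :=
  boolP [exists q, Q q && occupied x y A false true q].
- right; right=> p q Pp Qq.
  have /existsP[b /and3P[Bb /eqP h1 /eqP h2]] := oP _ _ _ _ Pp0 Pp o0.
  have /existsP[a /and3P[Aa /eqP h3 /eqP h4]] := oQ _ _ _ _ Qq0 Qq k0.
  have n1 := nxy _ _ (sP _ Pp) Bb; have n2 := nxy _ _ Aa (sQ _ Qq).
  have n3 := nxy _ _ (sP _ Pp) (sQ _ Qq).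
  rewrite ltNge; apply/negP => le.
  have [lt|ge] := ltP (x p) (x q).
    apply: (iB b q) => //; [exact: sQ | lia | lia].
  apply: (iA a p) => //; [exact: sP | lia | lia].
- left; right=> p q Pp Qq.
  have /existsP[b /and3P[Bb /eqP h1 /eqP h2]] := oP _ _ _ _ Pp0 Pp o0.
  have n1 := nxy _ _ (sP _ Pp) Bb; have n3 := nxy _ _ (sP _ Pp) (sQ _ Qq).
  have := existsPn nQ q; rewrite Qq /= => /existsPn/(_ p); rewrite sP //= => n2.
  rewrite ltNge; apply/negP => le.
  apply: (iB b q) => //; [exact: sQ | lia | lia].
- left; left=> p q Pp Qq.
  have /existsP[a /and3P[Aa /eqP h3 /eqP h4]] := oQ _ _ _ _ Qq0 Qq k0.
  have n2 := nxy _ _ Aa (sQ _ Qq); have n3 := nxy _ _ (sP _ Pp) (sQ _ Qq).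
  have := existsPn nP p; rewrite Pp /= => /existsPn/(_ q); rewrite sQ //= => n1.
  rewrite ltNge; apply/negP => le.
  apply: (iA a p) => //; [exact: sP | lia | lia].
- right; left=> p q Pp Qq.
  have n3 := nxy _ _ (sP _ Pp) (sQ _ Qq).
  have := existsPn nP p; rewrite Pp /= => /existsPn/(_ q); rewrite sQ //= => n1.
  have := existsPn nQ q; rewrite Qq /= => /existsPn/(_ p); rewrite sP //= => n2.
  lia.
Qed.

End Separation.

Section Reflection.
Variable T : finType.
Implicit Types (x y f : T -> int) (A B P Q : pred T).

Lemma discordant_opp x y p q : injective y -> p != q ->
  discordant x (fun r => - y r) p q = ~~ discordant x y p q.
Proof. by move=> yI; rewrite -(inj_eq yI) /discordant; lia. Qed.

Lemma homogeneous_opp x y v A : injective y ->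
  homogeneous x y v A -> homogeneous x (fun r => - y r) (~~ v) A.
Proof. by move=> yI hA p q Ap Aq npq; rewrite discordant_opp // hA. Qed.

Lemma occupied_opp x y B u v p : injective y -> ~~ B p ->
  occupied x (fun r => - y r) B u v p = occupied x y B u (~~ v) p.
Proof.
move=> yI nBp; apply: eq_existsb => b; case Bb: (B b) => //=.
have : p != b by apply: contraNneq nBp => ->; rewrite Bb.
by rewrite -(inj_eq yI); case: (_ == u) => //=; lia.
Qed.

Lemma separated_opp f P Q : separated (fun r => - f r) P Q -> separated f P Q.
Proof.
by case=> h; [right|left] => p q Pp Qq; move: (h p q Pp Qq); rewrite ltrN2.
Qed.

(** The remaining cases come from the previous two by exchanging the sequences
    and by reflecting the plane in a horizontal line, which complements
    discordance. *)
Lemma sep_or_homogeneous x y vA vB A B P Q : injective x -> injective y ->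
  homogeneous x y vA A -> homogeneous x y vB B ->
  (forall a, A a -> ~~ B a) -> cross_free x y A B ->
  (forall a, P a -> A a) -> (forall b, Q b -> B b) ->
  alike x y P B -> alike x y Q A ->
  [\/ separated x P Q, separated y P Q |
      vA = vB /\ forall p q, P p -> Q q -> discordant x y p q = vA].
Proof.
move=> xI yI hA hB dAB cf sP sQ oP oQ.
have dBA b : B b -> ~~ A b by apply/contraL/dAB.
case: vA vB hA hB => [] [] hA hB.
- have yI' : injective (fun r => - y r) by move=> p q /oppr_inj/yI.
  have nAB a b : A a -> B b -> a != b by move=> Aa; apply: contraTneq => <-; apply: dAB.
  have [||||||||h|h|h] := @sep_increasing T x (fun r => - y r) A B P Q xI yI'.
  + exact: homogeneous_opp hA.
  + exact: homogeneous_opp hB.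
  + exact: dAB.
  + move=> a a' b b' Aa Aa' Bb Bb'; rewrite !discordant_opp ?nAB //.
    have := cf _ _ _ _ Aa Aa' Bb' Bb; apply: contraNN.
    by do 4!case: (discordant _ _ _ _).
  + exact: sP.
  + exact: sQ.
  + move=> u v a a' Pa Pa'; rewrite !occupied_opp ?dAB ?sP //; exact: oP.
  + move=> u v b b' Qb Qb'; rewrite !occupied_opp ?dBA ?sQ //; exact: oQ.
  + exact: Or31.
  + by apply: Or32; apply: separated_opp.
  + apply: Or33; split=> // p q Pp Qq.
    by have := h p q Pp Qq; rewrite discordant_opp ?nAB ?sP ?sQ //;
      case: (discordant _ _ _ _).
- have [h|h] := @sep_inc_dec T x y B A Q P xI yI hB hA dBA sQ sP oQ oP.
  + by apply: Or31; apply: separated_sym.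
  + by apply: Or32; apply: separated_sym.
- have [h|h] := @sep_inc_dec T x y A B P Q xI yI hA hB dAB sP sQ oP oQ.
  + exact: Or31.
  + exact: Or32.
- have [h|h|h] := @sep_increasing T x y A B P Q xI yI hA hB dAB cf sP sQ oP oQ.
  + exact: Or31.
  + exact: Or32.
  + exact: Or33.
Qed.

End Reflection.

(** * Cutting at the extreme points of the classes *)

Section Cuts.
Variables (T C : finType) (c : T -> C).
Implicit Types f : T -> int.

(** The cuts passed on the way to [p]: one just before the least element of
    each class and one just after its greatest element. A class without
    elements contributes a cut that every point has passed. *)
Definition cut_set f (p : T) : {set C * bool} :=
  [set d | if d.2 then [exists r, (c r == d.1) && (f r <= f p)]
                  else [forall r, (c r == d.1) ==> (f r < f p)]].

Definition cut f (p : T) : nat := #|cut_set f p|.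

Lemma cut_set_mono f p q : f p <= f q -> cut_set f p \subset cut_set f q.
Proof.
move=> le; apply/subsetP => -[d []]; rewrite !inE /=.
  by case/existsP=> r /andP[h /le_trans/(_ le) k]; apply/existsP; exists r; rewrite h.
move/forallP=> h; apply/forallP => r; apply/implyP => /(implyP (h r)) k.
exact: lt_le_trans k le.
Qed.

Lemma cut_lt f p q : (cut f p < cut f q)%N -> f p < f q.
Proof.
by rewrite ltNge ltnNge => /negP h; apply/negP => /cut_set_mono/subset_leq_card.
Qed.

Lemma cut_bound f p : (cut f p < #|{: C * bool}|.+1)%N.
Proof. exact: max_card. Qed.

(** This is the purpose of the cuts: every class that meets the strip of [p]
    extends across the whole strip. *)
Lemma cut_hull f p q : cut f p = cut f q ->
  (exists2 r, c r = c q & f r <= f p) /\ (exists2 r, c r = c q & f p <= f r).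
Proof.
move=> e; have {e} e : cut_set f p = cut_set f q.
  have [le|/ltW le] := leP (f p) (f q).
    by apply/eqP; rewrite eqEcard cut_set_mono //= -/(cut f q) -e.
  by apply/esym/eqP; rewrite eqEcard cut_set_mono //= -/(cut f p) e.
split.
  have : (c q, true) \in cut_set f p.
    by rewrite e inE /=; apply/existsP; exists q; rewrite eqxx lexx.
  by rewrite inE /= => /existsP[r /andP[/eqP]]; exists r.
have : (c q, false) \notin cut_set f p.
  rewrite e inE /=; apply/forallPn; exists q; by rewrite eqxx ltxx.
rewrite inE /= => /forallPn[r]; rewrite negb_imply -leNgt => /andP[/eqP].
by exists r.
Qed.

(** Two pairs sharing a point [b] have the same value: if [a] is of the colour
    of [b], its pair is one of the pairs of that colour; otherwise the class
    of [b] extends on both sides of [a], hence contains a pair of distinct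
    points, and both values are equal to the value on that pair. *)
Lemma cell_constant (G : eqType) (g : T -> G) (V : T -> T -> bool) f :
  injective f -> symmetric V -> (forall p q, g p = g q -> cut f p = cut f q) ->
  (forall p q, p != q -> g p = g q ->
     forall r s, c r = c q -> c s = c q -> r != s -> V r s = V p q) ->
  forall p q p' q', p != q -> p' != q' -> g p = g q -> g p' = g q' -> g p = g p' ->
  V p q = V p' q'.
Proof.
move=> fI Vsym gcut hV.
have step a b d : a != b -> b != d -> g a = g b -> g d = g b -> V a b = V b d.
  move=> nab nbd eab edb; have h1 := hV _ _ nab eab.
  have h2 r s : c r = c b -> c s = c b -> r != s -> V r s = V b d.
    by rewrite (Vsym b) => *; apply: hV; rewrite // eq_sym.
  have [cab|ncab] := eqVneq (c a) (c b); first exact: h2.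
  have [[r1 c1 l1] [r2 c2 l2]] := cut_hull (gcut _ _ eab).
  have n12 : r1 != r2.
    apply: contra_neq ncab => e; rewrite -c1; congr c.
    by apply: fI; move: l1 l2; rewrite e; lia.
  by rewrite -(h1 r1 r2) // (h2 r1 r2).
move=> p q p' q' npq npq' ex ex' ex''.
have [e|nqp'] := eqVneq q p'.
  by rewrite -e; apply: step; rewrite ?e //; congruence.
apply: etrans (step _ _ p' npq nqp' _ _) _; try congruence.
by apply: step; congruence.
Qed.

Lemma cut_between f p q r : cut f p = cut f q ->
  f p < f r -> f r < f q -> cut f r = cut f p.
Proof.
move=> e /ltW/cut_set_mono/subset_leq_card h /ltW/cut_set_mono/subset_leq_card k.
by apply/eqP; rewrite eqn_leq h andbT e.
Qed.

End Cuts.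

(** * A bounded grid with monotone cells *)

Section Grid.
Variables (T S : finType) (x y : T -> int).
Hypotheses (xI : injective x) (yI : injective y).

(** The colours [c] and the order of the times [t] decide [Q] on pairs of
    distinct points. With [Q] the discordance of two points, this is a letter
    graph structure. *)
Definition determined (C : Type) (c : T -> C) (t : T -> int) (Q : T -> T -> bool) :=
  forall p q p' q', p != q -> p' != q' -> c p = c p' -> c q = c q' ->
    (t p < t q) = (t p' < t q') -> Q p q = Q p' q'.

Variables (l : T -> S) (t : T -> int).
Hypotheses (tI : injective t) (ltD : determined l t (discordant x y)).

Lemma letter_homogeneous (A : S) :
  exists v, homogeneous x y v (fun p => l p == A).
Proof.
have [/existsP[p /existsP[q /and3P[/eqP pA /eqP qA npq]]]|noP] :=
  boolP [exists p, exists q, [&& l p == A, l q == A & p != q]]; last first.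
  exists true => p q /eqP pA /eqP qA npq.
  by have /existsPn/(_ q) := existsPn noP p; rewrite pA qA eqxx npq.
exists (discordant x y p q) => p' q' /eqP pA' /eqP qA' npq'.
have [e|ne] := eqVneq (t p' < t q') (t p < t q).
  by apply: ltD; rewrite ?pA ?qA.
rewrite (discordant_sym xI yI); apply: ltD; rewrite ?pA ?qA // 1?eq_sym //.
move: npq npq'; rewrite -(inj_eq tI) -(inj_eq tI p'); lia.
Qed.

(** Discordance between the letters is a comparison of times, possibly
    reversed, or is constant; two independent edges would give a cycle of
    times. *)
Lemma letter_cross_free (A B : S) : A != B ->
  cross_free x y (fun p => l p == A) (fun p => l p == B).
Proof.
move=> nAB a a' b b' /eqP Aa /eqP Aa' /eqP Bb /eqP Bb'; apply/negP.
case/and4P=> d1 d2 d3 d4.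
have nab p q : l p = A -> l q = B -> p != q.
  by move=> Ap Bq; apply: contraNneq nAB => e; rewrite -Ap -Bq e.
have K p q p' q' : l p = A -> l q = B -> l p' = A -> l q' = B ->
  discordant x y p q -> ~~ discordant x y p' q' -> (t p < t q) != (t p' < t q').
  move=> Ap Bq Ap' Bq' d nd; apply: contraTneq d => e.
  by rewrite (ltD (nab _ _ Ap Bq) (nab _ _ Ap' Bq')) // ?Ap' ?Bq'.
have := K _ _ _ _ Aa Bb Aa Bb' d1 d3; have := K _ _ _ _ Aa Bb Aa' Bb d1 d4.
have := K _ _ _ _ Aa' Bb' Aa Bb' d2 d3; clear; lia.
Qed.

(** The part of [p] after its letter has been split according to the quadrants
    in which the other letters occur. *)
Definition part (p : T) : S * {set S * bool * bool} :=
  (l p, [set k | occupied x y (fun q => l q == k.1.1) k.1.2 k.2 p]).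

Lemma part_occupied A u v p q : part p = part q ->
  occupied x y (fun r => l r == A) u v p -> occupied x y (fun r => l r == A) u v q.
Proof. by case=> _ /setP/(_ (A, u, v)); rewrite !inE => ->. Qed.

(** The parts of two points of a cell extend across the column and the row of
    the cell, so no line separates them. *)
Lemma cell_part_homogeneous p q : p != q ->
  cut part x p = cut part x q -> cut part y p = cut part y q ->
  homogeneous x y (discordant x y p q) (fun r => part r == part q).
Proof.
move=> npq ex ey r s /eqP vr /eqP vs nrs.
have [[vA hA] [vB hB]] := (letter_homogeneous (l p), letter_homogeneous (l q)).
have lr : l r == l q by case: vr => ->.
have ls : l s == l q by case: vs => ->.
have [lpq|nl] := eqVneq (l p) (l q).
  by rewrite (hB r s) // (hB p q) // lpq.
have nsep f : cut part f p = cut part f q ->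
    ~ separated f (fun r => part r == part p) (fun r => part r == part q).
  move=> /cut_hull[[a va la] [b vb lb]] [] h.
    by have := h p a; rewrite eqxx va eqxx => /(_ isT isT); lia.
  by have := h p b; rewrite eqxx vb eqxx => /(_ isT isT); lia.
have [||||||h|h|[e h]] :=
  @sep_or_homogeneous T x y _ _ _ _ (fun r => part r == part p)
    (fun r => part r == part q) xI yI hA hB.
- by move=> a /eqP->.
- exact: letter_cross_free.
- by move=> a /eqP[->].
- by move=> a /eqP[->].
- by move=> u v a a' /eqP va /eqP va'; apply: part_occupied; rewrite va.
- by move=> u v a a' /eqP va /eqP va'; apply: part_occupied; rewrite va.
- by case: (nsep _ ex).
- by case: (nsep _ ey).
- by rewrite (hB r s) // -e h.
Qed.

Lemma cell_homogeneous p q p' q' : p != q -> p' != q' ->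
  cut part x p = cut part x q -> cut part y p = cut part y q ->
  cut part x p' = cut part x q' -> cut part y p' = cut part y q' ->
  cut part x p = cut part x p' -> cut part y p = cut part y p' ->
  discordant x y p q = discordant x y p' q'.
Proof.
move=> npq npq' ex ey ex' ey' ex'' ey''.
pose g p := (cut part x p, cut part y p).
apply: (@cell_constant _ _ part _ g (discordant x y) x xI) => //;
  rewrite /g; try congruence.
- exact: (discordant_sym xI yI).
- move=> a b nab [ea eb] r s vr vs nrs.
  by apply: (cell_part_homogeneous nab ea eb); rewrite ?vr ?vs.
Qed.

End Grid.

(** * Agreement of positions with times *)

Section Agreement.
Variable T : finType.
Implicit Types (f t : T -> int) (P Q : pred T).

Definition agree f t p q := (f p < f q) == (t p < t q).

Lemma agree_sym f t : injective f -> injective t -> symmetric (agree f t).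
Proof.
move=> fI tI p q; rewrite /agree; have [->|npq] := eqVneq p q; first by [].
move: npq (npq); rewrite -{1}(inj_eq tI) -(inj_eq fI); lia.
Qed.

(** Moving from [r1] to [r2] across [p] reverses the horizontal comparison
    with [p], hence also the comparison of times. This fixes the sign with
    which all comparisons between the two classes follow time, and it is the
    sign of the pair [r1], [r2]. *)
Lemma agree_across f t P Q p r1 r2 :
  (forall p q p' q', P p -> Q q -> P p' -> Q q' ->
     (t p < t q) = (t p' < t q') -> (f p < f q) = (f p' < f q')) ->
  P p -> Q r1 -> Q r2 -> f r1 < f p -> f p < f r2 ->
  forall p' q, P p' -> Q q -> agree f t p' q = agree f t r1 r2.
Proof.
move=> det Pp Q1 Q2 l1 l2 p' q Pp' Qq.
have h1 := det _ _ _ _ Pp' Qq Pp Q1; have h2 := det _ _ _ _ Pp' Qq Pp Q2.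
have h3 := det _ _ _ _ Pp Q1 Pp Q2.
have e1 : (f p < f r1) = false by lia.
have e3 : f r1 < f r2 by lia.
move: h1 h2 h3; rewrite /agree e1 l2 e3.
case: (ltP (t p') (t q)); case: (ltP (t p) (t r1)); case: (ltP (t p) (t r2)).
all: move=> k1 k2 k3 h1 h2 h3; lia.
Qed.

(** Two points of different colours in one strip are each straddled by the
    colour of the other, so [agree_across] transfers the sign of either colour
    to the pair. *)
Lemma column_agree (C : finType) (c : T -> C) f t :
  injective f -> injective t -> determined c t (fun p q => f p < f q) ->
  forall p q p' q', p != q -> p' != q' ->
  cut c f p = cut c f q -> cut c f p' = cut c f q' -> cut c f p = cut c f p' ->
  agree f t p q = agree f t p' q'.
Proof.
move=> fI tI det.
have asym := agree_sym fI tI.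
have same r s r' s' : r != s -> r' != s' -> c r = c s -> c r' = c s' -> c r = c r' ->
    agree f t r s = agree f t r' s'.
  move=> nrs nrs' ers ers' err'.
  have [e|ne] := eqVneq (t r < t s) (t r' < t s').
    by rewrite /agree e (det r s r' s') // -ers err' ers'.
  rewrite asym /agree; have e : (t s < t r) = (t r' < t s').
    by move: nrs nrs'; rewrite -(inj_eq tI) -(inj_eq tI r'); lia.
  have nsr : s != r by rewrite eq_sym.
  by rewrite e (det s r r' s') //; congruence.
apply: (@cell_constant _ _ c _ (cut c f) (agree f t) f fI) => //.
move=> p q npq epq r s cr cs nrs.
have [cpq|ncpq] := eqVneq (c p) (c q); first by apply: same => //; congruence.
have [[r1 c1 l1] [r2 c2 l2]] := cut_hull epq.
have nr1 : f r1 != f p by rewrite inj_eq //; apply: contraNneq ncpq => <-; rewrite c1.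
have nr2 : f r2 != f p by rewrite inj_eq //; apply: contraNneq ncpq => <-; rewrite c2.
have n12 : r1 != r2 by apply: contraNneq nr2 => e; move: l1 l2; rewrite -e; lia.
rewrite (same r s r1 r2) //; try congruence.
apply/esym/(@agree_across f t (fun r => c r == c p) (fun r => c r == c q) p r1 r2);
  rewrite ?c1 ?c2 //; try lia.
move=> a b a' b' /eqP ea /eqP eb /eqP ea' /eqP eb'; apply: det; try congruence.
  by apply: contraNneq ncpq => e; rewrite -ea -eb e.
by apply: contraNneq ncpq => e; rewrite -ea' -eb' e.
Qed.

End Agreement.

(** * Orienting the classes of a monotone grid *)

Section Separators.
Variables (T C : finType) (x y : T -> int) (gx gy : T -> nat) (c : T -> C).
Variable u : T -> int.

Definition same_cell p q := (gx p == gx q) && (gy p == gy q).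

(** The state of the argument between the two rounds of cuts: a grid with
    monotone cells, in which colours refine cells, and times [u] that coincide
    exactly on the points of a cell that nothing outside the cell separates.
    *)
Record timed_grid : Prop := TimedGrid {
  tg_x : injective x;
  tg_y : injective y;
  tg_gx : forall p q, (gx p < gx q)%N -> x p < x q;
  tg_gy : forall p q, (gy p < gy q)%N -> y p < y q;
  tg_cell : forall p q, c p = c q -> same_cell p q;
  tg_homog : forall p q p' q', p != q -> p' != q' -> same_cell p q ->
    same_cell p' q' -> same_cell p p' -> discordant x y p q = discordant x y p' q';
  tg_det : forall p q p' q', u p != u q -> u p' != u q' -> c p = c p' ->
    c q = c q' -> (u p < u q) = (u p' < u q') ->
    discordant x y p q = discordant x y p' q';
  tg_color : forall p q, u p = u q -> c p = c q;
  tg_sep : forall p q, same_cell p q -> u p != u q -> exists2 b, ~~ same_cell p b &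
    ((x b < x p) != (x b < x q)) || ((y b < y p) != (y b < y q));
  tg_unsep : forall p q b, u p = u q -> ~~ same_cell p b ->
    (x b < x p) = (x b < x q) /\ (y b < y p) = (y b < y q)
}.

Lemma index_mono (f : T -> int) (g : T -> nat) :
  (forall p q, (g p < g q)%N -> f p < f q) ->
  forall p q, f p < f q -> (g p <= g q)%N.
Proof. by move=> gf p q; rewrite leqNgt; apply: contraL => /gf/ltW; rewrite leNgt. Qed.

End Separators.

(** The axes play the same part: what holds for [x] holds for [y]. *)
Lemma timed_grid_swap (T C : finType) (x y : T -> int) gx gy (c : T -> C) u :
  timed_grid x y gx gy c u -> timed_grid y x gy gx c u.
Proof.
have sw p q : same_cell gy gx p q = same_cell gx gy p q by rewrite /same_cell andbC.
case=> xI yI hgx hgy cell homog det color sep unsep; split=> //.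
- by move=> p q; rewrite sw; apply: cell.
- by move=> p q p' q'; rewrite !sw !(discordant_swap x y); apply: homog.
- by move=> p q p' q'; rewrite !(discordant_swap x y); apply: det.
- by move=> p q; rewrite sw => h /(sep _ _ h)[b nb]; rewrite orbC; exists b; rewrite ?sw.
- by move=> p q b e; rewrite sw => /(unsep _ _ _ e)[].
Qed.

Section ClassAgree.
Variables (T C : finType) (x y : T -> int) (gx gy : T -> nat) (c : T -> C).
Variable u : T -> int.
Hypothesis tg : timed_grid x y gx gy c u.

Lemma cell_eq p q : same_cell gx gy p q -> gx p = gx q /\ gy p = gy q.
Proof. by case/andP=> /eqP-> /eqP->. Qed.

Lemma agree_symu p q : u p != u q -> agree x u p q = agree x u q p.
Proof.
move=> nu; have nx : x p != x q.
  by apply: contraNneq nu => /(tg_x tg) ->.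
by move: nu nx; rewrite /agree; lia.
Qed.

Lemma outside_time p b : ~~ same_cell gx gy p b -> u p != u b.
Proof. by apply: contraNneq => /(tg_color tg)/(tg_cell tg). Qed.

Lemma sep_time p q b : ~~ same_cell gx gy p b -> (x b < x p) != (x b < x q) -> u p != u q.
Proof. by move=> nb; apply: contraNneq => /(tg_unsep tg)/(_ nb)[->]. Qed.

(** A separating point lies in the column of the points that it separates;
    being outside their cell, it is in another row. *)
Lemma sep_row p q b : same_cell gx gy p q -> ~~ same_cell gx gy p b ->
  (x b < x p) != (x b < x q) -> gx b = gx p /\ gy b != gy p.
Proof.
move=> /cell_eq[ex ey] nb nx.
have nbp : x b != x p.
  by apply: contraNneq nb => /(tg_x tg) ->; rewrite /same_cell !eqxx.
have nbq : x b != x q.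
  by apply: contraNneq nb => /(tg_x tg) ->; rewrite /same_cell ex ey !eqxx.
have m := index_mono (tg_gx tg).
have e : gx b = gx p.
  have [lt|ge] := ltP (x b) (x p); have [lt'|ge'] := ltP (x b) (x q).
  - by move: nx; rewrite lt lt'.
  - have := m _ _ lt; have := m q b; lia.
  - have := m _ _ lt'; have := m p b; lia.
  - by move: nx; rewrite !ltNge ge ge'.
by split=> //; apply: contraNneq nb => e'; rewrite /same_cell e e' !eqxx.
Qed.

(** Between two rows the vertical order is known, and discordance becomes a
    comparison of [x]. *)
Lemma rows_det p b p' b' : gy p != gy b -> c p = c p' -> c b = c b' ->
  (u p < u b) = (u p' < u b') -> (x p < x b) = (x p' < x b').
Proof.
move=> ny cp cb eu.
have [ep ep'] := cell_eq (tg_cell tg cp); have [eb eb'] := cell_eq (tg_cell tg cb).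
have out q d : gy q != gy d -> u q != u d.
  by move=> n; apply: outside_time; rewrite /same_cell negb_and n orbT.
have ny' : gy p' != gy b' by rewrite -ep' -eb'.
have := tg_det tg (out _ _ ny) (out _ _ ny') cp cb eu; rewrite /discordant.
have -> : (y p < y b) = (y p' < y b').
  have m := tg_gy tg.
  have [h|h] : (gy p < gy b)%N \/ (gy b < gy p)%N by lia.
    by rewrite !m // -ep' -eb'.
  rewrite !ltNge; congr (~~ _).
  by rewrite !ltW // m // -ep' -eb'.
by move/addIb.
Qed.

(** Seen from a class, the two sides of a separating point [b] are the times
    before and after the time of [b], in one order or the other. The set [k]
    is the left side. *)
Lemma threshold p q : c p = c q -> u p != u q ->
  (exists2 b, ~~ same_cell gx gy p b & (x b < x p) != (x b < x q)) ->
  exists (k : T -> bool) (theta : int) (e : bool),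
    [/\ forall a, c a = c p -> k a = ((u a < theta) == e), k p != k q
       & forall a a', x a < x a' -> k a' -> k a].
Proof.
move=> cpq nu [b nb nx].
have scpq := tg_cell tg cpq.
have [ebx eby] := sep_row scpq nb nx.
have [gxpq gypq] := cell_eq scpq.
have nx' : (x p < x b) != (x q < x b).
  have nbp : x b != x p.
    by apply: contraNneq nb => /(tg_x tg) ->; rewrite /same_cell !eqxx.
  have nbq : x b != x q.
    by apply: contraNneq nb => /(tg_x tg) ->; rewrite /same_cell gxpq gypq !eqxx.
  by move: nx nbp nbq; clear; lia.
exists (fun a => x a < x b), (u b), ((u p < u b) == (x p < x b)); split=> //; last first.
  by move=> a a'; apply: lt_trans.
move=> a ca; have nby : gy p != gy b by rewrite eq_sym.
have h1 := @rows_det p b a b nby (esym ca) erefl.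
have h3 := @rows_det p b q b nby cpq erefl.
have h2 := @rows_det q b a b; rewrite -gypq -cpq in h2.
have {h2} := h2 nby (esym ca) erefl; move: h1 h3 nx'.
by do 3!case: (x _ < x b); do 3!case: (u _ < u b) => //=;
  move=> h1 h2 h3 h4; first [by []|have := h1 erefl|have := h2 erefl|have := h4 erefl].
Qed.

End ClassAgree.

Section ClassSign.
Variables (T C : finType) (x y : T -> int) (gx gy : T -> nat) (c : T -> C).
Variable u : T -> int.
Hypothesis tg : timed_grid x y gx gy c u.

(** In a decreasing cell a vertical separation gives the upper side, which is
    replaced by its complement. *)
Lemma threshold_any p q : c p = c q -> u p != u q ->
  exists (k : T -> bool) (theta : int) (e : bool),
    [/\ forall a, c a = c p -> k a = ((u a < theta) == e), k p != k q
       & forall a a', c a = c p -> c a' = c p -> x a < x a' -> k a' -> k a].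
Proof.
move=> cpq nu; have scpq := tg_cell tg cpq.
have [b nb /orP[nx|ny]] := tg_sep tg scpq nu.
  have [|k [th [e [h1 h2 h3]]]] := threshold tg cpq nu; first by exists b.
  by exists k, th, e; split=> // a a' _ _; apply: h3.
have [|k [th [e [h1 h2 h3]]]] := threshold (timed_grid_swap tg) cpq nu.
  by exists b; rewrite // /same_cell andbC.
have npq : p != q by apply: contraNneq nu => ->.
have hom a a' : c a = c p -> c a' = c p -> a != a' ->
    discordant x y a a' = discordant x y p q.
  move=> ca ca' na; apply: (tg_homog tg) => //; apply: (tg_cell tg); congruence.
have [v|v] := boolP (discordant x y p q).
  exists (fun a => ~~ k a), th, (~~ e); split.
  - by move=> a /h1 ->; case: (u a < th); case: (e).
  - by move: h2; case: (k p); case: (k q).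
  move=> a a' ca ca' lx; apply: contraNN; apply: h3.
  have na : a != a' by apply: contraTneq lx => ->; rewrite ltxx.
  have ny' : y a' != y a by rewrite eq_sym (inj_eq (tg_y tg)).
  by have := hom _ _ ca ca' na; rewrite v /discordant lx addTb; move: ny'; clear; lia.
exists k, th, e; split=> // a a' ca ca' lx; apply: h3.
have na : a != a' by apply: contraTneq lx => ->; rewrite ltxx.
by have := hom _ _ ca ca' na; rewrite (negbTE v) /discordant lx; case: (y a < _).
Qed.

(** Each pair is separated by a threshold. The leftmost of the four points
    lies on the left of both thresholds and the rightmost on the right of
    both, so this pair follows time with the sign of either threshold. *)
Lemma class_agree p q p' q' : c p = c q -> c p' = c q' -> c p = c p' ->
  u p != u q -> u p' != u q' -> agree x u p q = agree x u p' q'.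
Proof.
have xI := tg_x tg.
move=> cpq cpq' cpp' nu nu'.
wlog kp : p q cpq cpp' nu / exists (k : T -> bool) (theta : int) (e : bool),
    [/\ forall a, c a = c p -> k a = ((u a < theta) == e), k p /\ ~~ k q
       & forall a a', c a = c p -> c a' = c p -> x a < x a' -> k a' -> k a].
  move=> H; have [k [th [e [h1 h2 h3]]]] := threshold_any cpq nu.
  have [kp|kp] := boolP (k p).
    apply: H => //; exists k, th, e; split=> //; split=> //.
    by move: h2; rewrite kp; case: (k q).
  rewrite (agree_symu tg nu); apply: H; rewrite 1?eq_sym //; first by congruence.
  exists k, th, e; split; first by rewrite -cpq.
    by split=> //; move: h2; rewrite (negbTE kp); case: (k q).
  by rewrite -cpq.
wlog kp' : p' q' cpq' cpp' nu' / exists (k : T -> bool) (theta : int) (e : bool),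
    [/\ forall a, c a = c p -> k a = ((u a < theta) == e), k p' /\ ~~ k q'
       & forall a a', c a = c p -> c a' = c p -> x a < x a' -> k a' -> k a].
  move=> H; have [k [th [e [h1 h2 h3]]]] := threshold_any cpq' nu'.
  rewrite -cpp' in h1 h3.
  have [kp0|kp0] := boolP (k p').
    apply: H => //; exists k, th, e; split=> //; split=> //.
    by move: h2; rewrite kp0; case: (k q').
  rewrite (agree_symu tg nu'); apply: H; rewrite 1?eq_sym //; try congruence.
  exists k, th, e; split=> //.
  by split=> //; move: h2; rewrite (negbTE kp0); case: (k q').
case: kp => k [th [e [h1 [kp nkq] h3]]].
case: kp' => k' [th' [e' [h1' [kp' nkq'] h3']]].
have main (kk : T -> bool) tt ee a a' :
    (forall a, c a = c p -> kk a = ((u a < tt) == ee)) ->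
    (forall a a', c a = c p -> c a' = c p -> x a < x a' -> kk a' -> kk a) ->
    c a = c p -> c a' = c p -> kk a -> ~~ kk a' -> agree x u a a' = ee.
  move=> g1 g3 ca ca' ka na.
  have lx : x a < x a'.
    rewrite lt_neqAle; apply/andP; split.
      by apply: contraTneq ka => /xI ->.
    by rewrite leNgt; apply: contraNN na => /(g3 _ _ ca' ca)/(_ ka).
  by move: ka na; rewrite !g1 // /agree lx; clear; case: ee; lia.
rewrite (main k th e p q) // (main k' th' e' p' q') //; try congruence.
(* the leftmost and the rightmost of the four points *)
pose m := if x p <= x p' then p else p'.
pose M := if x q <= x q' then q' else q.
have cm : c m = c p by rewrite /m; case: ifP; congruence.
have cM : c M = c p by rewrite /M; case: ifP; congruence.
have low (kk : T -> bool) :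
    (forall a a', c a = c p -> c a' = c p -> x a < x a' -> kk a' -> kk a) ->
    forall a a', c a = c p -> c a' = c p -> x a <= x a' -> kk a' -> kk a.
  move=> g a a' ca ca'; rewrite le_eqVlt => /orP[/eqP/xI->//|]; exact: g.
rewrite -(main k th e m M) // -1?(main k' th' e' m M) //.
- apply: (low _ h3' m p') => //; rewrite /m; by case: (leP (x p) (x p')) => // /ltW.
- apply: contraNN nkq'; apply: (low _ h3' q' M); rewrite ?cM //; try congruence.
  by rewrite /M; case: (leP (x q) (x q')) => // /ltW.
- apply: (low _ h3 m p) => //; rewrite /m; by case: (leP (x p) (x p')) => // /ltW.
- apply: contraNN nkq; apply: (low _ h3 q M); rewrite ?cM //; try congruence.
  by rewrite /M; case: (leP (x q) (x q')) => // /ltW.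
Qed.

End ClassSign.

Section CrossColour.
Variables (T C : finType) (x y : T -> int) (gx gy : T -> nat) (c : T -> C).
Variable u : T -> int.
Hypothesis tg : timed_grid x y gx gy c u.

(** After the cuts, the class of [d] lies on both sides of [b]. *)
Lemma hull_agree d b : gy d != gy b -> cut c x d = cut c x b ->
  exists r1 r2, [/\ c r1 = c d, c r2 = c d, u r1 != u r2
                  & agree x u b d = agree x u r1 r2].
Proof.
move=> ny /esym/cut_hull[[r1 c1 l1] [r2 c2 l2]].
have row r : c r = c d -> gy r = gy d by move=> /(tg_cell tg)/cell_eq[].
have out r : c r = c d -> ~~ same_cell gx gy r b.
  by move=> /row e; rewrite /same_cell negb_and e ny orbT.
have nx r : c r = c d -> x r != x b.
  by move=> /out; apply: contraNneq => /(tg_x tg) ->; rewrite /same_cell !eqxx.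
have {l1} l1 : x r1 < x b by rewrite lt_neqAle l1 nx.
have {l2} l2 : x b < x r2 by rewrite lt_neqAle l2 eq_sym nx.
exists r1, r2; split=> //.
  by apply: (sep_time tg (out _ c1)); rewrite l2 ltNge ltW.
apply: (@agree_across _ x u (fun r => c r == c b) (fun r => c r == c d) b);
  rewrite ?c1 ?c2 //.
move=> p q p' q' /eqP ep /eqP eq /eqP ep' /eqP eq'.
apply: (rows_det tg); try congruence.
rewrite (row q) //; have [_ ->] := cell_eq (tg_cell tg ep); by rewrite eq_sym.
Qed.

(** The point [b] lies in the strip of [p] and [q] and its class straddles
    both, so all comparisons of [b] with [p] and with [q] have the sign of the
    class of [b]; the class of [p] straddles [b] and has this sign too. *)
Lemma cross_agree p q b : same_cell gx gy p q -> cut c x p = cut c x q ->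
  ~~ same_cell gx gy p b -> (x b < x p) != (x b < x q) ->
  exists r s, [/\ c r = c p, c s = c p, u r != u s
                & agree x u p q = agree x u r s].
Proof.
move=> spq cutpq nb nx.
have [_ ny] := sep_row tg spq nb nx.
have [ex ey] := cell_eq spq.
have nb' : ~~ same_cell gx gy q b.
  by move: nb; rewrite /same_cell ex ey.
have cutb : cut c x b = cut c x p.
  have [lt|ge] := ltP (x b) (x p); have [lt'|ge'] := ltP (x b) (x q).
  - by move: nx; rewrite lt lt'.
  - rewrite cutpq; apply: (cut_between (esym cutpq)) => //.
    rewrite lt_neqAle ge' andbT; apply: contraNneq nb' => /(tg_x tg) ->.
    by rewrite /same_cell !eqxx.
  - apply: (cut_between cutpq) => //.
    rewrite lt_neqAle ge andbT; apply: contraNneq nb => /(tg_x tg) ->.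
    by rewrite /same_cell !eqxx.
  - by move: nx; rewrite !ltNge ge ge'.
have nyp : gy p != gy b by rewrite eq_sym.
have nyq : gy q != gy b by rewrite -ey.
have [r [s [cr cs urs e]]] := hull_agree nyp (esym cutb).
have [r1 [s1 [cr1 cs1 urs1 e1]]] := hull_agree ny cutb.
have ny' : gy b != gy q by rewrite eq_sym.
have [r2 [s2 [cr2 cs2 urs2 e2]]] := hull_agree ny' (etrans cutb cutpq).
exists r, s; split=> //; rewrite -e.
have e3 : agree x u p b = agree x u q b.
  by rewrite e1 e2; apply: (class_agree tg) => //; congruence.
have xbp : x b != x p.
  by apply: contraNneq nb => /(tg_x tg) ->; rewrite /same_cell !eqxx.
have xbq : x b != x q.
  by apply: contraNneq nb' => /(tg_x tg) ->; rewrite /same_cell !eqxx.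
have ubp := outside_time tg nb; have ubq := outside_time tg nb'.
move: e3 nx xbp xbq ubp ubq; rewrite /agree; clear; lia.
Qed.

End CrossColour.

Section Retiming.
Variables (T C : finType) (x y : T -> int) (gx gy : T -> nat) (c : T -> C).
Variables (u : T -> int) (N : int).
Hypothesis tg : timed_grid x y gx gy c u.
Hypothesis xN : forall p, 0 <= x p < N.

(** The common value of [agree] on the pairs of the class [d] with different
    times. *)
Definition class_sign (d : C) :=
  [exists p, exists q, [&& c p == d, c q == d, x p < x q & u p < u q]].

Lemma class_signP p q : c p = c q -> u p != u q -> agree x u p q = class_sign (c p).
Proof.
move=> cpq nu; have [/existsP[r /existsP[s /and4P[/eqP cr /eqP cs lx lu]]]|no] :=
  boolP (class_sign _).
  have nrs : u r != u s by rewrite lt_eqF.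
  rewrite (@class_agree _ _ _ _ _ _ _ _ tg p q r s) //; try congruence.
  by rewrite /agree lx lu.
have h a b : c a = c p -> c b = c p -> ~~ ((x a < x b) && (u a < u b)).
  by move=> ca cb; have := existsPn (existsPn no a) b; rewrite ca cb !eqxx.
have := h p q erefl (esym cpq); have := h q p (esym cpq) erefl.
have nx : x p != x q by apply: contraNneq nu => /(tg_x tg) ->.
by move: nu nx; rewrite /agree; clear; lia.
Qed.

(** Points with equal times are spread out in time, in the direction that
    agrees with the sign of its class; multiplication by [2 * N] leaves room
    for this between two consecutive times. *)
Definition retime (p : T) : int :=
  u p * (2 * N) + (if class_sign (c p) then x p else - x p).

Lemma retime_lt p q : u p < u q -> retime p < retime q.
Proof.
move=> lt; have := xN p; have := xN q; rewrite /retime => hq hp.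
have : (u p + 1) * (2 * N) <= u q * (2 * N) by apply: ler_wpM2r; lia.
rewrite mulrDl mul1r; case: (class_sign _); case: (class_sign _); lia.
Qed.

Lemma retime_mono p q : u p != u q -> (retime p < retime q) = (u p < u q).
Proof.
have [lt|gt|//] := ltgtP (u p) (u q) => _; first exact: retime_lt.
by apply/negbTE; rewrite -leNgt ltW // retime_lt.
Qed.

Lemma retime_inj : injective retime.
Proof.
move=> p q e; have [lt|gt|eu] := ltgtP (u p) (u q).
- by have := retime_lt lt; rewrite e ltxx.
- by have := retime_lt gt; rewrite e ltxx.
apply: (tg_x tg); move: e; rewrite /retime eu (tg_color tg eu) => /addrI.
by case: ifP => // _ /oppr_inj.
Qed.

(** A vertical separation gives the statement for [y], which transfers to [x]
    because the cell is monotone. *)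
Lemma cross_sign p q : same_cell gx gy p q -> cut c x p = cut c x q ->
  cut c y p = cut c y q -> u p != u q -> agree x u p q = class_sign (c p).
Proof.
move=> spq cutx cuty nu; have [b nb /orP[nx|ny]] := tg_sep tg spq nu.
  have [r [s [cr cs urs ->]]] := cross_agree tg spq cutx nb nx.
  by rewrite class_signP ?cr //; congruence.
have tg' := timed_grid_swap tg.
have spq' : same_cell gy gx p q by rewrite /same_cell andbC.
have nb' : ~~ same_cell gy gx p b by rewrite /same_cell andbC.
have [r [s [cr cs urs e]]] := cross_agree tg' spq' cuty nb' ny.
rewrite -cr -(@class_signP r s) //; last congruence.
have npq : p != q by apply: contraNneq nu => ->.
have nrs : r != s by apply: contraNneq urs => ->.
have := tg_homog tg npq nrs spq (tg_cell tg (etrans cr (esym cs))) (tg_cell tg (esym cr)).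
by move: e; rewrite /agree /discordant; do 4!case: (_ < _); do 2!case: (_ < _).
Qed.

Lemma retime_agree p q : p != q -> same_cell gx gy p q -> cut c x p = cut c x q ->
  cut c y p = cut c y q -> agree x retime p q = class_sign (c p).
Proof.
move=> npq spq cutx cuty; have [eu|nu] := eqVneq (u p) (u q); last first.
  by rewrite -(cross_sign spq) // /agree retime_mono.
rewrite /agree /retime eu (tg_color tg eu) ltrD2l.
have : x p != x q by rewrite (inj_eq (tg_x tg)).
by case: ifP; lia.
Qed.

Lemma retime_discordant : determined c retime (discordant x y).
Proof.
move=> p q p' q' npq npq' cp cq er.
have out a b : ~~ same_cell gx gy a b -> u a != u b.
  exact: (@outside_time _ _ _ _ _ _ _ _ tg).
have [ep1 ep2] := cell_eq (tg_cell tg cp); have [eq1 eq2] := cell_eq (tg_cell tg cq).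
have [s|ns] := boolP (same_cell gx gy p q).
  apply: (tg_homog tg) => //; last exact: (tg_cell tg).
  by move: s; rewrite /same_cell ep1 ep2 eq1 eq2.
have ns' : ~~ same_cell gx gy p' q' by move: ns; rewrite /same_cell ep1 ep2 eq1 eq2.
by apply: (tg_det tg); rewrite ?out // -!retime_mono ?out.
Qed.

Definition retime_color (p : T) : C * ('I_#|{: C * bool}|.+1 * 'I_#|{: C * bool}|.+1) :=
  (c p, (Ordinal (cut_bound c x p), Ordinal (cut_bound c y p))).

(** Points in different columns or different strips are in the order of these.
    Otherwise, points in different rows have a known vertical order, and
    discordance gives the horizontal one. What remains are the points of one
    refined cell, which [retime_agree] settles. *)
Lemma retime_x : determined retime_color retime (fun p q => x p < x q).
Proof.
move=> p q p' q' npq npq' [cp exp eyp] [cq exq eyq] er.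
have mono (f : T -> int) (g : T -> nat) : (forall a b, (g a < g b)%N -> f a < f b) ->
    g p != g q -> g p = g p' -> g q = g q' -> (f p < f q) = (f p' < f q').
  move=> h; rewrite neq_ltn => /orP[lt|gt] e1 e2; first by rewrite !h // -e1 -e2.
  by rewrite !ltNge !ltW ?h // -e1 -e2.
have [ep1 ep2] := cell_eq (tg_cell tg cp); have [eq1 eq2] := cell_eq (tg_cell tg cq).
have dd : discordant x y p q = discordant x y p' q' by exact: (retime_discordant npq).
have fromy : (y p < y q) = (y p' < y q') -> (x p < x q) = (x p' < x q').
  by move: dd; rewrite /discordant => + e; rewrite e => /addIb.
have [e1|n1] := eqVneq (gx p) (gx q); last exact: (mono x gx (tg_gx tg)).
have [e2|n2] := eqVneq (gy p) (gy q); last exact/fromy/(mono y gy (tg_gy tg)).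
have [e3|n3] := eqVneq (cut c x p) (cut c x q); last exact: (mono x _ (@cut_lt _ _ c x)).
have [e4|n4] := eqVneq (cut c y p) (cut c y q);
  last exact/fromy/(mono y _ (@cut_lt _ _ c y)).
have h1 : agree x retime p q = class_sign (c p).
  by apply: retime_agree; rewrite // /same_cell e1 e2 !eqxx.
have h2 : agree x retime p' q' = class_sign (c p').
  apply: retime_agree; rewrite // /same_cell; try congruence.
  by rewrite -ep1 -ep2 -eq1 -eq2 e1 e2 !eqxx.
by move: h1 h2; rewrite /agree -cp er; case: (class_sign _); do 3!case: (_ < _).
Qed.

Lemma retime_y : determined retime_color retime (fun p q => y p < y q).
Proof.
move=> p q p' q' npq npq' ep eq er.
have := retime_x npq npq' ep eq er; have [[cp _ _] [cq _ _]] := (ep, eq).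
have := retime_discordant npq npq' cp cq er; rewrite /discordant => + e.
by rewrite e => /addbI.
Qed.

End Retiming.

(** * Collapsing the points that nothing outside their cell separates *)

Section Twins.
Variables (T S : finType) (x y : T -> int).
Hypotheses (xI : injective x) (yI : injective y).
Variables (l : T -> S) (t : T -> int).
Hypotheses (tI : injective t) (ltD : determined l t (discordant x y)).

Let v := part x y l.
Let gx := cut v x.
Let gy := cut v y.

(** All that can be seen of [p] from outside its cell. *)
Definition outer_view (p : T) : nat * nat * ({set T} * {set T}) :=
  (gx p, gy p, ([set b | ~~ same_cell gx gy p b && (x b < x p)],
                [set b | ~~ same_cell gx gy p b && (y b < y p)])).

(** The choice depends on the outer view of [p] only, hence is common to all
    points with this view. *)
Definition twin_rep (p : T) : T := odflt p [pick q | outer_view q == outer_view p].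

Lemma twin_rep_view p : outer_view (twin_rep p) = outer_view p.
Proof. by rewrite /twin_rep; case: pickP => [q /eqP|]. Qed.

Lemma twin_rep_eq p q : outer_view p = outer_view q -> twin_rep p = twin_rep q.
Proof.
rewrite /twin_rep => e; rewrite (eq_pick (Q := fun r => outer_view r == outer_view q)).
  by case: pickP => // /(_ q); rewrite eqxx.
by move=> r; rewrite /= e.
Qed.

Lemma same_cell_outer p q b : outer_view p = outer_view q ->
  same_cell gx gy p b = same_cell gx gy q b.
Proof. by case=> ex ey _ _; rewrite /same_cell ex ey. Qed.

Lemma outer_view_lt p q b : outer_view p = outer_view q -> ~~ same_cell gx gy p b ->
  (x b < x p) = (x b < x q) /\ (y b < y p) = (y b < y q).
Proof.
move=> e nb; have nb' : ~~ same_cell gx gy q b by rewrite -(same_cell_outer b e).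
by case: e => _ _ /setP/(_ b) + /setP/(_ b); rewrite !inE nb nb'.
Qed.

Lemma grid_homogeneous p q p' q' : p != q -> p' != q' -> same_cell gx gy p q ->
  same_cell gx gy p' q' -> same_cell gx gy p p' ->
  discordant x y p q = discordant x y p' q'.
Proof.
move=> npq npq' /cell_eq[e1 e2] /cell_eq[e3 e4] /cell_eq[e5 e6].
exact: (cell_homogeneous xI yI tI ltD).
Qed.

(** Points with the same outer view form a module of the inversion graph:
    points outside their cell do not separate them, and the points of their
    cell are all discordant or all concordant with them. *)
Lemma outer_view_discordant p q b : outer_view p = outer_view q -> b != p -> b != q ->
  discordant x y b p = discordant x y b q.
Proof.
move=> e nbp nbq; have [s|ns] := boolP (same_cell gx gy p b); last first.
  by rewrite /discordant; case: (outer_view_lt e ns) => -> ->.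
have s' : same_cell gx gy q b by rewrite -(same_cell_outer b e).
have [e1 e2] := cell_eq s; have [e3 e4] := cell_eq s'.
by apply: grid_homogeneous; rewrite // /same_cell ?e1 ?e2 ?e3 ?e4 !eqxx.
Qed.

Lemma twin_rep_discordant p q : outer_view p != outer_view q ->
  discordant x y p q = discordant x y (twin_rep p) (twin_rep q).
Proof.
move=> n; have e1 := twin_rep_view p; have e2 := twin_rep_view q.
have ne a b : outer_view a = outer_view p -> outer_view b = outer_view q -> a != b.
  by move=> ea eb; apply: contraNneq n => e; rewrite -ea -eb e.
rewrite (@outer_view_discordant q (twin_rep q) p) ?ne //.
by rewrite !(discordant_sym xI yI _ (twin_rep q));
  apply: outer_view_discordant; rewrite // eq_sym ne.
Qed.

(** The cell is included because the points gathered around one representative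
    may form a decreasing sequence although the letter of the representative
    is increasing, or conversely. *)
Definition twin_color (p : T) :
    S * ('I_#|{: S * {set S * bool * bool} * bool}|.+1 *
         'I_#|{: S * {set S * bool * bool} * bool}|.+1) :=
  (l (twin_rep p), (Ordinal (cut_bound v x p), Ordinal (cut_bound v y p))).

Lemma twin_times : timed_grid x y gx gy twin_color (fun p => t (twin_rep p)).
Proof.
have tview p q : t (twin_rep p) != t (twin_rep q) -> outer_view p != outer_view q.
  by apply: contraNneq => /twin_rep_eq->.
have viewt p q : t (twin_rep p) = t (twin_rep q) -> outer_view p = outer_view q.
  by move=> /tI e; rewrite -(twin_rep_view p) e twin_rep_view.
split=> //.
- by move=> p q; apply: cut_lt.
- by move=> p q; apply: cut_lt.
- by move=> p q [_ ex ey]; rewrite /same_cell /gx /gy ex ey !eqxx.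
- exact: grid_homogeneous.
- move=> p q p' q' /[dup] nt /tview n /[dup] nt' /tview n' [lp _ _] [lq _ _] et.
  rewrite (twin_rep_discordant n) (twin_rep_discordant n'); apply: ltD => //.
    by apply: contraNneq nt => ->.
  by apply: contraNneq nt' => ->.
- move=> p q /[dup] /viewt [ex ey _ _] /tI e; rewrite /twin_color e.
  by congr (_, (_, _)); apply: val_inj.
- move=> p q s /tview n; have [ex ey] := cell_eq s.
  have same b : same_cell gx gy p b = same_cell gx gy q b by rewrite /same_cell ex ey.
  have [/existsP[b /andP[nb h]]|no] := boolP [exists b, ~~ same_cell gx gy p b &&
    (((x b < x p) != (x b < x q)) || ((y b < y p) != (y b < y q)))]; first by exists b.
  case/eqP: n; rewrite /outer_view ex ey; congr (_, (_, _)); apply/setP => b.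
    rewrite !inE -same; case nb: (same_cell _ _ p b) => //=.
    by have := existsPn no b; rewrite nb /= negb_or !negbK => /andP[/eqP->].
  rewrite !inE -same; case nb: (same_cell _ _ p b) => //=.
  by have := existsPn no b; rewrite nb /= negb_or !negbK => /andP[_ /eqP->].
- by move=> p q b /viewt/outer_view_lt h /h.
Qed.

End Twins.

(** * Drawing on a checkerboard *)

Section Placement.
Variables (R : realType) (T C : finType) (c : T -> C) (t : T -> int).
Hypothesis tI : injective t.

(** Any increasing map from times to the open unit interval would do. *)
Definition age (p : T) : R := (#|[set r | t r < t p]|.+1)%:R / (#|T|.+1)%:R.

Lemma age_bounds p : 0 < age p < 1.
Proof.
rewrite /age divr_gt0 ?ltr0Sn //= ltr_pdivrMr ?ltr0Sn // mul1r ltr_nat ltnS.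
rewrite -cardsT proper_card // properT; apply/negP => /eqP/setP/(_ p).
by rewrite !inE ltxx.
Qed.

Lemma age_lt p q : t p < t q -> age p < age q.
Proof.
move=> lt; rewrite /age ltr_pM2r ?invr_gt0 ?ltr0Sn // ltr_nat ltnS.
apply/proper_card/properP; split.
  by apply/subsetP => r; rewrite !inE => /lt_trans; apply.
by exists p; rewrite !inE ?ltxx.
Qed.

Variable f : T -> int.
Hypotheses (fI : injective f) (det : determined c t (fun p q => f p < f q)).

Definition forward_column (p : T) : bool :=
  [forall a, forall b, [&& cut c f a == cut c f p, cut c f b == cut c f p & a != b]
     ==> agree f t a b].

Lemma forward_columnP p q : p != q -> cut c f p = cut c f q ->
  agree f t p q = forward_column p.
Proof.
move=> npq e; have [/forallP h|] := boolP (forward_column p).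
  by apply: (implyP (forallP (h p) q)); rewrite e !eqxx.
case/forallPn=> a /forallPn[b]; rewrite negb_imply.
move=> /andP[/and3P[/eqP ea /eqP eb nab] h].
by apply/negbTE; rewrite (column_agree fI tI det npq nab) //; congruence.
Qed.

(** Each strip gets two columns of the checkerboard, one for each direction;
    the points use the column that suits the direction of their strip. *)
Definition slot (p : T) : nat := (cut c f p).*2 + ~~ forward_column p.

Definition place (p : T) : R :=
  (slot p)%:R + (if forward_column p then age p else 1 - age p).

Lemma slot_bound p : (slot p < (#|{: C * bool}|.+1).*2)%N.
Proof. by rewrite /slot; have := cut_bound c f p; case: (forward_column p); lia. Qed.

Lemma place_bounds p : (slot p)%:R < place p < (slot p).+1%:R.
Proof.
rewrite -natr1 /place ltrDl ltrD2l; have /andP[h k] := age_bounds p.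
by case: ifP => _; rewrite ?h ?k // subr_gt0 k gtrBl h.
Qed.

Lemma place_lt p q : f p < f q -> place p < place q.
Proof.
move=> lt; have npq : p != q by apply: contraTneq lt => ->; rewrite ltxx.
have := index_mono (@cut_lt _ _ c f) lt; rewrite leq_eqVlt => /orP[/eqP e|lte].
  have h := forward_columnP npq e.
  have hq : agree f t p q = forward_column q.
    by rewrite (agree_sym fI tI) forward_columnP // eq_sym.
  have nt : t p != t q by rewrite inj_eq.
  rewrite /place /slot -hq -h e ltrD2l; move: h hq; rewrite /agree lt => _ _.
  case: ifP => [/eqP/esym/age_lt//|] => ht; rewrite ltrD2l ltrN2; apply: age_lt.
  by rewrite lt_neqAle eq_sym nt leNgt; move: ht; case: (t p < t q).
have /andP[_ h1] := place_bounds p; have /andP[h2 _] := place_bounds q.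
apply: lt_trans h1 (le_lt_trans _ h2); rewrite ler_nat /slot.
by move: lte; clear; case: (forward_column p); case: (forward_column q); lia.
Qed.

End Placement.

Definition checkerboard (m : nat) : 'M[int]_(m, m) :=
  \matrix_(i, j) (if odd (i + j) then -1 else 1).

Lemma checkerboard_pm1 m : zero_pm1_matrix (checkerboard m).
Proof. by move=> i j; rewrite mxE; case: ifP. Qed.

(** The parity of the cell of a point tells whether its column and its row
    have the same direction, hence whether the point moves along an increasing
    or a decreasing segment as its age grows. *)
Lemma geom_of_determined (R : realType) (C : finType) (n : nat) (p : 'S_n)
    (c : 'I_n -> C) (t : 'I_n -> int) :
  injective t -> determined c t (fun i j => abscissa i < abscissa j) ->
  determined c t (fun i j => ordinate p i < ordinate p j) ->
  Geom R (checkerboard (#|{: C * bool}|.+1).*2) p.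
Proof.
move=> tI dx dy.
have xI := @abscissa_inj n; have yI := @ordinate_inj n p.
exists (fun i => (place R c t (@abscissa n) i, place R c t (ordinate p) i)).
split=> [i|i j lt|i j lt]; last 2 first.
- by apply: place_lt; rewrite // /abscissa /ordinate ltz_nat.
- by apply: (place_lt _ _ yI dy); rewrite // /abscissa /ordinate ltz_nat.
exists (Ordinal (slot_bound c t (@abscissa n) i)).
exists (Ordinal (slot_bound c t (ordinate p) i)).
have /andP[s0 s1] := age_bounds R t i.
rewrite mxE /= /slot /place /slot.
set a := cut _ _ i; set b := cut _ _ i.
have odd_slot d e : odd (a.*2 + d + (b.*2 + e)) = odd (d + e).
  by rewrite !oddD !odd_double.
rewrite odd_slot /open_segment /=.
have s1' : 0 < 1 - age R t i < 1 by rewrite subr_gt0 s1 gtrBl s0.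
have s0' : 0 < age R t i < 1 by rewrite s0.
case: (forward_column _ _ _ _); case: (forward_column _ _ _ _) => /=;
  [left|right|right|left];
  split=> //.
- by exists (age R t i) => //; rewrite !addn0 -!natr1; congr (_, _); ring.
- by exists (age R t i) => //; rewrite addn0 addn1 -!natr1; congr (_, _); ring.
- by exists (1 - age R t i) => //; rewrite addn0 addn1 -!natr1; congr (_, _); ring.
- by exists (1 - age R t i) => //; rewrite !addn1 -!natr1; congr (_, _); ring.
Qed.

(** * The equivalence *)

(** The alphabet is embedded in ['I_r], so that the number of colours used
    afterwards depends on [r] only. *)
Lemma letter_coding n (p : 'S_n) r : (lettericity (inversion_graph p) <= r)%N ->
  exists (l : 'I_n -> 'I_r) (t : 'I_n -> int),
    injective t /\ determined l t (discordant (@abscissa n) (ordinate p)).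
Proof.
rewrite /lettericity; case: ex_minnP => k.
move=> /boolp.asboolP[S [D [m [w [cS [f [fB fA]]]]]]] _ le.
rewrite -cS in le.
exists (fun i => widen_ord le (enum_rank (tnth w (f i)))), (fun i => (f i)%:Z); split.
  by move=> i j [] /val_inj/(bij_inj fB).
move=> i j i' j' nij nij' [/ord_inj/enum_rank_inj li] [/ord_inj/enum_rank_inj lj].
rewrite -!inv_adj_discordant // !ltz_nat => e.
have := fA i j; have := fA i' j'; rewrite /= => <- <-.
rewrite /letter_adj li lj e; congr (_ || _ && _).
have nf a b : a != b -> (f b < f a)%N = ~~ (f a < f b)%N.
  by move=> nab; rewrite -leqNgt ltn_neqAle (inj_eq (@ord_inj _)) (bij_eq fB) eq_sym nab.
by rewrite (nf i j) // (nf i' j') // e.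
Qed.

(** The three successive numbers bound the number of columns, and of rows,
    after each round of cuts; the last one is doubled to offer both
    directions. *)
Lemma bounded_lettericity_griddable (R : realType) (C : perm_set) :
  bounded_lettericity (inversion_graph_class C) -> geometrically_griddable R C.
Proof.
case=> r hr.
pose K := #|{: 'I_r * {set 'I_r * bool * bool} * bool}|.+1.
pose L := #|{: 'I_r * ('I_K * 'I_K) * bool}|.+1.
pose m := #|{: 'I_r * ('I_K * 'I_K) * ('I_L * 'I_L) * bool}|.+1.*2.
exists m, m, (checkerboard m); split; first exact: checkerboard_pm1.
move=> n p Cp; have [|l [t [tI lt]]] := @letter_coding n p r.
  apply: hr; exists n, p; split=> //; exists id; split=> //; exact: (Bijective (g := id)).
have xI := @abscissa_inj n; have yI := @ordinate_inj n p.
have tg := twin_times xI yI tI lt.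
have xN (i : 'I_n) : 0 <= abscissa i < n%:Z by rewrite /abscissa ltz_nat ltn_ord.
exact: (geom_of_determined R (retime_inj tg xN) (retime_x tg xN) (retime_y tg xN)).
Qed.

Theorem theorem1p1 (R : realType) (C : perm_set) (hC : perm_class C) :
  geometrically_griddable R C <->
  bounded_lettericity (inversion_graph_class C).
Proof.
split; last exact: bounded_lettericity_griddable.
case=> t [u [M [_ CM]]]; exists #|{: 'I_t * 'I_u * bool}| => G [n [p [Cp iso]]].
exact/lettericity_le/(is_letter_graph_iso iso)/geom_letter_graph/CM.
Qed.
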